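(* Let $f\colon \mathbb{R}\times\mathbb{R}\to\mathbb{R}$ be a function, let $\alpha,\beta\in\mathbb{R}$, and let $m,n\geq 1$ be integers. Assume that $f(\alpha,\alpha)$, $f(\beta,\beta)$ and $f(\alpha,\beta)-f(\beta,\alpha)$ are all nonzero. Let $\mu\in\mathbb{C}$ be a complex number with \[ \mu^{2}=\frac{f(\alpha,\alpha)\,f(\beta,\beta)}{\bigl(f(\alpha,\beta)-f(\beta,\alpha)\bigr)^{2}}. \] Let $M\in\mathsf{Sym}(f;\alpha^{(m)},\beta^{(n)})$. Then there exists a bipartite graph $G_M$ with part sizes $m$ and $n$ such that \[ m+n-2-\nu\;\leq\;\operatorname{rank}(M)\;\leq\; m+n+2-\nu, \] where $\nu$ is the multiplicity of $\mu$ as an eigenvalue of (the adjacency matrix of) $G_M$ (with $\nu=0$ if $\mu$ is not an eigenvalue). In particular, if $f(\alpha,\alpha)f(\beta,\beta)<0$, then $\operatorname{rank}(M)\geq m+n-2$.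
   Context: For a function $f$ and a tuple $(a_1,\dots,a_N)$ of reals, $\mathsf{Sym}(f;a_1,\dots,a_N)$ denotes the set of all $N\times N$ real symmetric matrices with zero diagonal whose $(i,j)$th entry, for each $i<j$, is either $f(a_i,a_j)$ or $f(a_j,a_i)$. The notation $(\alpha^{(m)},\beta^{(n)})$ denotes the tuple $(\alpha,\dots,\alpha,\beta,\dots,\beta)$ consisting of $m$ copies of $\alpha$ followed by $n$ copies of $\beta$. (The graph constructed in the paper has vertices $v_1,\dots,v_m$ and $w_1,\dots,w_n$, with $v_i w_j$ an edge iff $M(i,m+j)=f(\alpha,\beta)$.) *)

(* Defs.v *)
From mathcomp Require Import all_boot all_order all_algebra.
From mathcomp Require Import complex.
From mathcomp Require Import classical_sets reals.

Set Implicit Arguments.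
Unset Strict Implicit.
Unset Printing Implicit Defensive.

Import Order.TTheory GRing.Theory Num.Theory.

Local Open Scope ring_scope.

Definition Sym (R : realType) (f : R -> R -> R) (N : nat) (a : N.-tuple R) :
    set 'M[R]_N :=
  [set M | [/\ M^T = M,
               forall i, M i i = 0
             & forall i j : 'I_N, (i < j)%N ->
                 M i j = f (tnth a i) (tnth a j) \/
                 M i j = f (tnth a j) (tnth a i)]]%classic.

(* The tuple (alpha^(m), beta^(n)). *)
Definition two_block (T : Type) (m n : nat) (alpha beta : T) : (m + n).-tuple T :=
  [tuple of [tuple of nseq m alpha] ++ [tuple of nseq n beta]].

(* Finite simple graphs with vertex set 'I_N. *)
Record sgraph (N : nat) := SGraph {
  edge :> rel 'I_N;
  edge_sym : symmetric edge;
  edge_irrefl : irreflexive edge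
}.

Definition bipartite_with_parts (N : nat) (G : sgraph N) (m n : nat) : Prop :=
  exists A B : {set 'I_N},
    [/\ A :|: B = [set: 'I_N], [disjoint A & B], #|A| = m, #|B| = n
      & forall x y, G x y ->
          (x \in A) && (y \in B) || (x \in B) && (y \in A)].

Definition adjacency (K : pzRingType) (N : nat) (G : sgraph N) : 'M[K]_N :=
  \matrix_(i, j) (G i j)%:R.

(* Algebraic multiplicity; it is 0 when a is not an eigenvalue of A. *)
Definition eigen_mult (K : fieldType) (N : nat) (A : 'M[K]_N) (a : K) : nat :=
  mup a (char_poly A).

(* Main.v *)
Require Import Defs.
From mathcomp Require Import all_boot all_order all_algebra.
From mathcomp Require Import complex.
From mathcomp Require Import classical_sets reals.
From mathcomp Require Import spectral ring zify.

(** With [a = f alpha alpha], [d = f beta beta] and [c = f alpha beta -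
f beta alpha], the matrix [M] is [[-a I, c B], [c B^T, -d I]], where [B] is a
0/1 matrix, plus a matrix which is constant on the four blocks and hence of rank
at most 2. Over the complex numbers, scaling the block rows and columns turns
the first summand into [A - mu I], with [A] the adjacency matrix of the
bipartite graph defined by [B]. Since [A] is real symmetric, it is
diagonalizable, so [A - mu I] has rank [m + n - nu]. When [a d < 0], [mu] is not
real, whereas all eigenvalues of [A] are, so [nu = 0]. *)

Import Order.TTheory GRing.Theory Num.Theory.

Local Open Scope ring_scope.
Local Open Scope complex_scope.

(** * Ranks and eigenvalue multiplicities of Hermitian matrices *)

Lemma rank_diag_mx {F : fieldType} {n : nat} (d : 'rV[F]_n) :
  (\rank (diag_mx d) + \sum_i (d 0%R i == 0%R) = n)%N.
Proof.
elim: n d => [|n IHn] d; first by rewrite big_ord0 flatmx0 mxrank0.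
rewrite -[n.+1]/(1 + n)%N in d *.
rewrite -[d]hsubmxK diag_mx_row rank_diag_block_mx big_split_ord /= big_ord1.
under eq_bigr do rewrite row_mxEr.
have -> : diag_mx (lsubmx d) = (lsubmx d 0 0)%:M.
  by apply/matrixP => i j; rewrite !mxE !ord1.
rewrite row_mxEl addnACA IHn rank_rV -scalemx1 scaler_eq0.
by rewrite oner_eq0 orbF; case: eqP.
Qed.

(** Since ['X%:M] is central and [P] stays invertible as a matrix of constant polynomials,
    conjugation passes to the characteristic matrix, and the determinant does not see it. *)
Lemma char_poly_conj {R : comUnitRingType} {n : nat} (P D : 'M[R]_n) :
  P \in unitmx -> char_poly (invmx P *m D *m P) = char_poly D.
Proof.
move=> uP; rewrite /char_poly /char_poly_mx.
have PK : map_mx polyC (invmx P) *m map_mx polyC P = 1%:M.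
  by rewrite -map_mxM /= mulVmx // map_mx1.
have -> : 'X%:M - map_mx polyC (invmx P *m D *m P) =
    map_mx polyC (invmx P) *m ('X%:M - map_mx polyC D) *m map_mx polyC P.
  by rewrite mulmxBr mulmxBl !map_mxM /= scalar_mxC -(mulmxA 'X%:M) PK mulmx1.
by rewrite !det_mulmx mulrAC -det_mulmx PK det1 mul1r.
Qed.

Lemma mup_char_poly_diag {F : fieldType} {n : nat} (d : 'rV[F]_n) (x : F) :
  mup x (char_poly (diag_mx d)) = (\sum_i (d 0%R i == x))%N.
Proof.
rewrite char_poly_trig ?diag_mx_is_trig //.
have -> : \prod_(i < n) ('X - (diag_mx d i i)%:P) =
    \prod_(y <- [seq d 0 i | i : 'I_n]) ('X - y%:P).
  by rewrite big_image; apply: eq_bigr => i _; rewrite mxE eqxx mulr1n.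
rewrite mu_prod_XsubC count_map -sum1_count big_mkcond big_enum /=.
by apply: eq_bigr => i _; case: eqP.
Qed.

(** By the spectral theorem [A - x%:M] is conjugate to a diagonal matrix with entries [d 0 i - x]:
    the nonzero ones make up the rank, the zero ones the multiplicity of [x]. *)
Lemma rank_hermitian_sub_scalar {C : numClosedFieldType} {n : nat}
    (A : 'M[C]_n) (x : C) :
  A \is hermsymmx -> (\rank (A - x%:M)%R + eigen_mult A x = n)%N.
Proof.
move=> /hermitian_normalmx/orthomx_spectralP.
have := spectral_unit A.
move: (spectralmx A) (spectral_diag A) => P d uP defA.
have -> : A - x%:M = invmx P *m diag_mx (d - const_mx x) *m P.
  rewrite linearB /= diag_const_mx mulmxBr mulmxBl -defA.
  by rewrite scalar_mxC -mulmxA mulVmx ?mulmx1.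
rewrite mxrankMfree ?row_free_unit // eqmxMfull ?row_full_unit ?unitmx_inv //.
rewrite /eigen_mult defA char_poly_conj // mup_char_poly_diag.
rewrite -[RHS](rank_diag_mx (d - const_mx x)); congr addn.
by apply: eq_bigr => i _; rewrite !mxE subr_eq0.
Qed.

(** The multiplicity counts the entries of the spectral diagonal equal to [x], and all these entries
    are real. *)
Lemma eigen_mult_hermitian_nonreal {C : numClosedFieldType} {n : nat}
    (A : 'M[C]_n) (x : C) :
  A \is hermsymmx -> x \isn't Num.real -> eigen_mult A x = 0%N.
Proof.
move=> hA xNreal; have /mxOverP d_real := hermitian_spectral_diag_real hA.
have /orthomx_spectralP defA := hermitian_normalmx hA.
rewrite /eigen_mult [X in char_poly X]defA char_poly_conj ?spectral_unit //.
rewrite mup_char_poly_diag big1 // => i _.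
by case: eqP => // eq_x; rewrite -eq_x d_real in xNreal.
Qed.

(** * Ranks of two-by-two block matrices *)

Lemma rank_two_block_scale {F : fieldType} {m n : nat} (a c d mu : F)
    (B : 'M[F]_(m, n)) (B' : 'M[F]_(n, m)) :
  a != 0 -> c != 0 -> mu != 0 -> mu ^+ 2 * c ^+ 2 = a * d ->
  \rank (block_mx (- a)%:M (c *: B) (c *: B') (- d)%:M) =
  \rank (block_mx 0 B B' 0 - mu%:M).
Proof.
move=> a0 c0 mu0 hmu.
(* The right factors [a / mu] and [c] correct the upper blocks; the left factor [c * mu / a] then
   restores [c] in the lower left block. *)
have -> : block_mx (- a)%:M (c *: B) (c *: B') (- d)%:M =
    block_mx 1%:M 0 0 (c * mu / a)%:M *m (block_mx 0 B B' 0 - mu%:M) *m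
    block_mx (a / mu)%:M 0 0 c%:M.
  rewrite scalar_mx_block opp_block_mx add_block_mx.
  rewrite !mulmx_block !(mul0mx, mulmx0, addr0, add0r, subr0, oppr0, mul1mx).
  rewrite !(mul_scalar_mx, mul_mx_scalar) -!rmorphN /= !scale_scalar_mx !scalerA.
  congr block_mx.
  - by congr _%:M; field.
  - by congr (_ *: _); field; apply/andP.
  (* The lower right block has become [- (mu ^+ 2 * c ^+ 2 / a)], which is [- d] by [hmu]. *)
  congr _%:M; apply: (mulfI a0); rewrite mulrN -hmu; field.
  by [].
rewrite mxrankMfree ?row_free_unit ?block_diag_mx_unit.
  rewrite eqmxMfull // row_full_unit block_diag_mx_unit unitmx1 /=.
  by rewrite unitmxE det_scalar unitrX // unitfE !mulf_neq0 ?invr_eq0.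
by rewrite !unitmxE !det_scalar !unitrX // unitfE ?mulf_neq0 ?invr_eq0.
Qed.

(** Such a matrix factors through a space of dimension [1 + 1], one coordinate per block of rows. *)
Lemma rank_two_block_const {F : fieldType} {m n : nat} (a b b' d : F) :
  (\rank (block_mx (const_mx a : 'M_m) (const_mx b)
                   (const_mx b') (const_mx d : 'M_n)) <= 2)%N.
Proof.
have constM p q (x : F) :
    (const_mx 1 : 'M_(p, 1)) *m (const_mx x : 'M_(1, q)) = const_mx x.
  by apply/matrixP => i j; rewrite !mxE big_ord1 !mxE mul1r.
have -> : block_mx (const_mx a) (const_mx b) (const_mx b') (const_mx d) =
  (block_mx (const_mx 1) 0 0 (const_mx 1) : 'M[F]_(m + n, 1 + 1)) *m
  block_mx (const_mx a) (const_mx b) (const_mx b') (const_mx d).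
  by move=> p q; rewrite mulmx_block !mul0mx !addr0 !add0r !constM.
exact: mulmx_max_rank.
Qed.

(** * The bipartite graph of a 0/1 matrix *)

Section BipartiteGraph.

Context {m n : nat}.
Context (e : 'I_m -> 'I_n -> bool).

Definition bip_edge : rel 'I_(m + n) := fun x y =>
  match split x, split y with
  | inl i, inr j | inr j, inl i => e i j
  | _, _ => false
  end.

Lemma bip_edge_sym : symmetric bip_edge.
Proof. by move=> x y; rewrite /bip_edge; case: split; case: split. Qed.

Lemma bip_edge_irrefl : irreflexive bip_edge.
Proof. by move=> x; rewrite /bip_edge; case: split. Qed.

Definition bip_graph : sgraph (m + n) := SGraph bip_edge_sym bip_edge_irrefl.

Lemma bip_graph_bipartite : bipartite_with_parts bip_graph m n.
Proof.
exists [set lshift n i | i : 'I_m], [set rshift m j | j : 'I_n].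
have inL i : lshift n i \in [set lshift n i | i : 'I_m] by apply: imset_f.
have inR j : rshift m j \in [set rshift m j | j : 'I_n] by apply: imset_f.
split.
- apply/setP => x; rewrite !inE -[x]splitK.
  by case: split => k /=; rewrite ?inL ?inR ?orbT.
- rewrite disjoint_subset; apply/fintype.subsetP => _ /imsetP[i _ ->].
  rewrite inE; apply/negP => /imsetP[j _ /eqP].
  by rewrite eq_lrshift.
- by rewrite card_imset ?card_ord //; apply: lshift_inj.
- by rewrite card_imset ?card_ord //; apply: rshift_inj.
move=> x y; rewrite /= /bip_edge -{2 3}[x]splitK -{3 4}[y]splitK.
by case: (split x) => i; case: (split y) => j /= e_ij; rewrite ?inL ?inR ?orbT.
Qed.

Lemma adjacency_bip_graph (K : pzRingType) :
  let B : 'M[K]_(m, n) := \matrix_(i, j) (e i j)%:R in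
  adjacency K bip_graph = block_mx 0 B B^T 0.
Proof.
apply/matrixP => x y; rewrite mxE /= /bip_edge.
rewrite -{2}[x]splitK -{3}[y]splitK.
case: (split x) => i; case: (split y) => j /=;
  by rewrite ?(block_mxEul, block_mxEur, block_mxEdl, block_mxEdr) !mxE.
Qed.

End BipartiteGraph.

Lemma adjacency_hermitian {C : numClosedFieldType} {N : nat} (G : sgraph N) :
  adjacency C G \is hermsymmx.
Proof.
apply: realsym_hermsym.
  apply/is_hermitianmxP; rewrite expr0 scale1r.
  by apply/matrixP => i j; rewrite !mxE edge_sym.
by apply/mxOverP => i j; rewrite mxE realn.
Qed.

(** * Splitting [M] and comparing ranks *)

Lemma tnth_two_blockl {T : Type} {m n : nat} (x y : T) (i : 'I_m) :
  tnth (two_block m n x y) (lshift n i) = x.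
Proof. by rewrite tnth_lshift tnth_nseq. Qed.

Lemma tnth_two_blockr {T : Type} {m n : nat} (x y : T) (j : 'I_n) :
  tnth (two_block m n x y) (rshift m j) = y.
Proof. by rewrite tnth_rshift tnth_nseq. Qed.

Section TwoBlock.

Context {R : realType} {m n : nat}.
Context (f : R -> R -> R) (alpha beta : R) (M : 'M[R]_(m + n)).

Let a := f alpha alpha.
Let d := f beta beta.
Let b := f beta alpha.
Let c := f alpha beta - f beta alpha.

Definition two_block_graph : sgraph (m + n) :=
  bip_graph (fun i j => M (lshift n i) (rshift m j) == f alpha beta).

(** The diagonal of [M] is zero, so subtracting constant diagonal blocks [a] and [d] leaves [- a]
    and [- d] on it. *)
Definition two_block_core : 'M[R]_(m + n) :=
  let B := \matrix_(i, j) (M (lshift n i) (rshift m j) == f alpha beta)%:R in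
  block_mx (- a)%:M (c *: B) (c *: B^T) (- d)%:M.

Lemma two_block_coreE :
  Sym f (two_block m n alpha beta) M ->
  M = two_block_core +
      block_mx (const_mx a) (const_mx b) (const_mx b) (const_mx d).
Proof.
rewrite /two_block_core; set B := \matrix_(i, j) _ => /=.
case=> symM diagM entM.
(* The two admissible values are [f alpha beta], which is [c + b], and [f beta alpha], which is [b];
   [B] records the choice. *)
have Mur i j : M (lshift n i) (rshift m j) = c * B i j + b.
  rewrite mxE; case: eqP => [->|neq]; first by rewrite mulr1 subrK.
  have := entM (lshift n i) (rshift m j) (leq_trans (ltn_ord i) (leq_addr _ _)).
  by rewrite tnth_two_blockl tnth_two_blockr mulr0 add0r => -[/neq|].
have trM x y : M x y = M y x by rewrite -{1}symM mxE.
(* Within a diagonal block the two admissible values coincide, so there is no choice. *)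
have Mul i j : i != j -> M (lshift n i) (lshift n j) = a.
  have lt_eq (i' j' : 'I_m) : (i' < j')%N -> M (lshift n i') (lshift n j') = a.
    by move/(entM (lshift n i') (lshift n j')); rewrite !tnth_two_blockl; case.
  by case: (ltngtP i j) => [/lt_eq //|/lt_eq <-|/val_inj ->]; rewrite ?eqxx.
have Mdr i j : i != j -> M (rshift m i) (rshift m j) = d.
  have lt_eq (i' j' : 'I_n) : (i' < j')%N -> M (rshift m i') (rshift m j') = d.
    move=> ltij; have := entM (rshift m i') (rshift m j').
    by rewrite ltn_add2l !tnth_two_blockr => /(_ ltij) [].
  by case: (ltngtP i j) => [/lt_eq //|/lt_eq <-|/val_inj ->]; rewrite ?eqxx.
rewrite add_block_mx -[LHS]submxK; congr block_mx; apply/matrixP => i j.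
- rewrite !mxE; have [->|/Mul ->] := eqVneq i j; first by rewrite diagM addNr.
  by rewrite add0r.
- by rewrite [RHS]mxE [X in X + _]mxE [X in _ + X]mxE -Mur !mxE.
- rewrite [RHS]mxE [X in X + _]mxE [X in _ * X]mxE [X in _ + X]mxE -Mur -trM.
  by rewrite !mxE.
rewrite !mxE; have [->|/Mdr ->] := eqVneq i j; first by rewrite diagM addNr.
by rewrite add0r.
Qed.

(** The two matrices differ by one of rank at most 2, and rank is subadditive. *)
Lemma rank_two_block_core_near :
  Sym f (two_block m n alpha beta) M ->
  (\rank two_block_core <= \rank M + 2)%N /\
  (\rank M <= \rank two_block_core + 2)%N.
Proof.
move=> /two_block_coreE defM.
set K := block_mx (const_mx a) _ _ _ in defM.
have rK : (\rank K <= 2)%N by apply: rank_two_block_const.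
split; last first.
  by rewrite [X in (\rank X <= _)%N]defM (leq_trans (mxrank_add _ _)) ?leq_add2l.
have -> : two_block_core = M - K by rewrite [in RHS]defM addrK.
by rewrite (leq_trans (mxrank_add _ _)) // mxrank_opp leq_add2l.
Qed.

Lemma rank_two_block_core (mu : R[i]) :
  a != 0 -> d != 0 -> c != 0 -> mu ^+ 2 = (a * d / c ^+ 2)%:C ->
  (\rank two_block_core + eigen_mult (adjacency R[i] two_block_graph) mu = m + n)%N.
Proof.
move=> a0 d0 c0 hmu; have C0 (x : R) : (x%:C == 0) = (x == 0).
  exact: fmorph_eq0.
have mu0 : mu != 0.
  by rewrite -sqrf_eq0 hmu C0 !mulf_neq0 ?invr_eq0 ?sqrf_eq0.
have hA := adjacency_hermitian (C := R[i]) two_block_graph.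
rewrite -[RHS](rank_hermitian_sub_scalar _ mu hA).
congr addn; rewrite adjacency_bip_graph.
(* Rank is unchanged by extending scalars to [R[i]], where [mu] is available for the rescaling. *)
rewrite -(mxrank_map (real_complex R)) map_block_mx !map_scalar_mx !map_mxZ.
rewrite [X in block_mx X%:M]rmorphN [X in block_mx _ _ _ X%:M]rmorphN /=.
rewrite (rank_two_block_scale _ _ _ mu) ?C0 //.
  congr (\rank (block_mx _ _ _ _ - _)); apply/matrixP => i j; rewrite !mxE;
  exact: rmorph_nat.
by rewrite hmu -rmorphXn -!rmorphM /= mulfVK // sqrf_eq0.
Qed.

End TwoBlock.

Theorem theorem1p4 (R : realType) (f : R -> R -> R) (alpha beta : R) (m n : nat)
    (hm : (1 <= m)%N) (hn : (1 <= n)%N)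
    (haa : f alpha alpha != 0) (hbb : f beta beta != 0)
    (hab : f alpha beta - f beta alpha != 0)
    (mu : R[i])
    (hmu : mu ^+ 2 = (f alpha alpha * f beta beta /
                      (f alpha beta - f beta alpha) ^+ 2)%:C)
    (M : 'M[R]_(m + n)) (hM : Sym f (two_block m n alpha beta) M) :
  (exists G : sgraph (m + n),
     bipartite_with_parts G m n /\
     let nu := eigen_mult (adjacency R[i] G) mu in
     m%:Z + n%:Z - 2 - nu%:Z <= (\rank M)%:Z <= m%:Z + n%:Z + 2 - nu%:Z)
  /\ (f alpha alpha * f beta beta < 0 -> m%:Z + n%:Z - 2 <= (\rank M)%:Z).
Proof.
have [geM leM] := rank_two_block_core_near _ _ _ _ hM.
have rD := rank_two_block_core f alpha beta M mu haa hbb hab hmu.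
split; last first.
  (* With [nu = 0] the core has full rank [m + n], and [M] loses at most 2. *)
  move=> neg; rewrite eigen_mult_hermitian_nonreal ?adjacency_hermitian // in rD.
    by lia.
  (* A real [mu] would have a nonnegative square, but [hmu] and [neg] make [mu ^+ 2] negative. *)
  apply/negP => /real_exprn_even_ge0 /(_ (erefl : ~~ odd 2)).
  rewrite hmu lecR leNgt pmulr_llt0 ?neg //.
  by rewrite invr_gt0 lt0r sqrf_eq0 hab sqr_ge0.
exists (two_block_graph f alpha beta M).
split; first exact: bip_graph_bipartite.
move=> nu; rewrite -/nu in rD; lia.
Qed.
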